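(* Let $X$ be a subshift. If there exists a positive integer $n$ such that $\left| \bigcup_{1 \leq \ell \leq n} F_X(\ell) \right| \leq n$, then $X$ is sofic.
   Context: Let $A$ be a finite set (the alphabet). A subshift on $A$ is a shift-invariant subset $X$ of $A^{\mathbb{Z}}$ that is closed in the product topology. The language $L(X)$ is the set of all finite words which appear in points of $X$, and $L_n(X) = L(X)\cap A^n$. For $w \in L(X)$, the follower set $F_X(w)$ is the set of all right-infinite sequences $s \in A^{\mathbb{N}}$ such that the infinite word $ws$ occurs in some point of $X$. For a positive integer $n$, $F_X(n) = \{F_X(w) : w \in L_n(X)\}$ (a set of sets); thus $\bigcup_{1\le \ell \leq n} F_X(\ell)$ is the collection of all distinct follower sets of words of lengths $1,\dots,n$. A subshift is sofic if it is the image of a shift of finite type under a continuous shift-commuting map; equivalently, if $\{F_X(w) : w \in L(X)\}$ is finite. *)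

(* Defs.v *)
From HB Require Import structures.
From mathcomp Require Import all_boot all_order all_algebra.
From mathcomp Require Import all_classical all_reals all_analysis.
Set Implicit Arguments.
Unset Strict Implicit.
Unset Printing Implicit Defensive.
Import Order.TTheory GRing.Theory Num.Theory.
Local Open Scope classical_set_scope.
Local Open Scope ring_scope.

(* The product topology on A^Z, the alphabet being discrete. *)
Definition full_shift (A : finType) : topologicalType :=
  {ptws int -> discrete_topology A}.

Definition shift_map {A : finType} (x : full_shift A) : full_shift A :=
  fun i => x (i + 1).

Definition is_subshift {A : finType} (X : set (full_shift A)) : Prop :=
  shift_map @` X = X /\ closed X.

Definition occurs {A : finType} (w : seq A) (x : full_shift A) : Prop :=
  exists i : int, w = mkseq (fun k : nat => x (i + k%:Z)) (size w).

(* The right-infinite word ws. The default value of nth is never used. *)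
Definition word_cat {A : finType} (w : seq A) (s : nat -> A) : nat -> A :=
  fun k => if (k < size w)%N then nth (s 0%N) w k else s (k - size w)%N.

Definition occurs_inf {A : finType} (s : nat -> A) (x : full_shift A) : Prop :=
  exists i : int, forall k : nat, x (i + k%:Z) = s k.

Definition language {A : finType} (X : set (full_shift A)) : set (seq A) :=
  [set w | exists2 x, X x & occurs w x].

Definition language_n {A : finType} (X : set (full_shift A)) (n : nat) :
    set (seq A) :=
  language X `&` [set w | size w = n].

Definition follower {A : finType} (X : set (full_shift A)) (w : seq A) :
    set (nat -> A) :=
  [set s | exists2 x, X x & occurs_inf (word_cat w s) x].

Definition followers {A : finType} (X : set (full_shift A)) (n : nat) :
    set (set (nat -> A)) :=
  follower X @` language_n X n.

Definition is_SFT {A : finType} (X : set (full_shift A)) : Prop :=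
  exists F : seq (seq A),
    X = [set x | forall w, w \in F -> ~ occurs w x].

(* The factor map is total on the ambient full shift, but only its restriction
   to Y is constrained. *)
Definition is_sofic {A : finType} (X : set (full_shift A)) : Prop :=
  exists (B : finType) (Y : set (full_shift B))
         (phi : full_shift B -> full_shift A),
    [/\ is_SFT Y,
        {within Y, continuous phi},
        forall y, Y y -> phi (shift_map y) = shift_map (phi y)
      & phi @` Y = X].

(* Main.v *)
(* Let S_k be the set of follower sets of words of lengths 1, ..., k.  Since
   F(wa) depends only on F(w) and the letter a, an equality S_k = S_(k+1) with
   k >= 1 forces every S_m with m >= k to equal S_k.  If all letters have the
   same follower set then so has every word.  Otherwise |S_1| >= 2, and if S_k
   grew strictly up to k = n we would get |S_n| >= n + 1.  In both cases X has
   finitely many follower sets, and X is the set of label sequences of the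
   bi-infinite paths in the finite graph with edges F(w) -a-> F(wa). *)
Require Import Defs.
From mathcomp Require Import all_boot all_order all_algebra.
From mathcomp Require Import all_classical all_reals all_analysis.
From mathcomp Require Import finmap zify.
Set Implicit Arguments.
Unset Strict Implicit.
Unset Printing Implicit Defensive.
Import GRing.Theory.
Local Open Scope classical_set_scope.

(** * Words and their follower sets *)

Lemma word_cat_nth (A : finType) (w : seq A) (s : nat -> A) a k :
  (k < size w)%N -> word_cat w s k = nth a w k.
Proof. by move=> kw; rewrite /word_cat kw; exact: set_nth_default. Qed.

Lemma word_cat_addn (A : finType) (w : seq A) (s : nat -> A) k :
  word_cat w s (size w + k)%N = s k.
Proof. by rewrite /word_cat ltnNge leq_addr /= addKn. Qed.

Lemma word_cat_cat (A : finType) (w v : seq A) (s : nat -> A) :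
  word_cat (w ++ v) s = word_cat w (word_cat v s).
Proof.
apply/funext => k; case: (ltnP k (size w)) => kw.
  rewrite (@word_cat_nth _ _ _ (s 0%N)) ?size_cat ?ltn_addr//.
  by rewrite nth_cat kw (@word_cat_nth _ _ _ (s 0%N)).
rewrite -(subnKC kw) word_cat_addn.
case: (ltnP (k - size w) (size v)) => kv.
  rewrite !(@word_cat_nth _ _ _ (s 0%N)) ?size_cat ?ltn_add2l//.
  by rewrite nth_cat ltnNge leq_addr /= addKn.
by rewrite -(subnKC kv) addnA -size_cat !word_cat_addn.
Qed.

(** Any occurrence of [w] in a point continues to the right, so membership in the language can be
    read off the follower set alone. *)
Lemma language_follower (A : finType) (X : set (full_shift A)) (w : seq A) :
  language X w <-> exists s, follower X w s.
Proof.
split=> [[x Xx [i wE]]|[s [x Xx [i xE]]]].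
  exists (fun k => x (i + (size w + k)%N%:Z)%R), x => //; exists i => k.
  case: (ltnP k (size w)) => kw; last by rewrite -(subnKC kw) word_cat_addn.
  by rewrite (@word_cat_nth _ _ _ (x i))// wE nth_mkseq// -wE.
exists x => //; exists i; apply: (@eq_from_nth _ (s 0%N)); rewrite ?size_mkseq//.
by move=> k kw; rewrite nth_mkseq// xE (@word_cat_nth _ _ _ (s 0%N)).
Qed.

(** The right side involves [w] only through its follower set, which makes follower sets the
    vertices of a labelled graph. *)
Lemma follower_cat (A : finType) (X : set (full_shift A)) (w v : seq A) :
  follower X (w ++ v) = word_cat v @^-1` follower X w.
Proof. by apply/funext => s; rewrite /follower /preimage /= word_cat_cat. Qed.

Lemma follower_suffix (A : finType) (X : set (full_shift A)) (w v : seq A) :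
  follower X (w ++ v) `<=` follower X v.
Proof.
move=> s [x Xx [i xE]]; exists x => //; exists (i + (size w)%:Z)%R => k.
by rewrite -(word_cat_addn w (word_cat v s)) -word_cat_cat -xE PoszD addrA.
Qed.

Lemma language_prefix (A : finType) (X : set (full_shift A)) (w v : seq A) :
  language X (w ++ v) -> language X w.
Proof.
move=> /language_follower[s]; rewrite follower_cat => ws.
by apply/language_follower; exists (word_cat v s).
Qed.

Lemma language_suffix (A : finType) (X : set (full_shift A)) (w v : seq A) :
  language X (w ++ v) -> language X v.
Proof.
move=> /language_follower[s /follower_suffix vs].
by apply/language_follower; exists s.
Qed.

Lemma follower_cat_congr (A : finType) (X : set (full_shift A)) (w w' v : seq A) :
  follower X w = follower X w' -> language X (w ++ v) ->
  language X (w' ++ v) /\ follower X (w ++ v) = follower X (w' ++ v).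
Proof.
move=> ww' /language_follower wvX; rewrite !follower_cat ww'; split=> //.
by apply/language_follower; move: wvX; rewrite !follower_cat ww'.
Qed.

(** * Translation and convergence in the full shift *)

Lemma subshift_translate (A : finType) (X : set (full_shift A))
    (x : full_shift A) (m : int) :
  is_subshift X -> X x -> X (fun i => x (i + m)%R).
Proof.
move=> [sX _] Xx.
(* Forward translation uses that the shift maps [X] into itself, backward translation that it maps
   [X] onto itself. *)
have fwd n : X (fun i => x (i + n%:Z)%R).
  elim: n => [|n Xn]; first by under eq_fun do rewrite addr0.
  rewrite -sX; exists (fun i => x (i + n%:Z)%R) => //; apply/funext => i.
  by rewrite /shift_map; congr x; lia.
have bwd n : X (fun i => x (i - n%:Z)%R).
  elim: n => [|n]; first by under eq_fun do rewrite subr0.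
  rewrite -{1}sX => -[z Xz zE]; suff -> : (fun i => x (i - n.+1%:Z)%R) = z by [].
  apply/funext => i; have := congr1 (fun g => g (i - 1)%R) zE.
  rewrite /shift_map subrK => ->; congr x; lia.
by case: m => n; [exact: fwd|rewrite NegzE; exact: bwd].
Qed.

Lemma full_shift_cvg (A : finType) (F : set_system (full_shift A))
    (x : full_shift A) :
  Filter F -> (forall i, \forall y \near F, y i = x i) -> F --> x.
Proof.
move=> FF Fx; apply/cvg_sup => i U [] /= V [[W oW WV]] Vx VU.
apply: filterS (Fx i) => y yx; apply: VU; rewrite -WV /= yx.
by move: Vx; rewrite -WV.
Qed.

Lemma near_coordinate (A : finType) (x : full_shift A) (i : int) :
  \forall y \near x, y i = x i.
Proof.
have := @proj_continuous int (fun=> discrete_topology A) i x.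
by move=> /(_ [set x i]); apply; rewrite nbhs_principalE; apply/principal_filterP.
Qed.

Lemma closed_pointwise (A : finType) (X : set (full_shift A)) (x : full_shift A) :
  closed X ->
  (forall n : nat, exists2 z, X z & forall i, (`|i| <= n)%N -> z i = x i) -> X x.
Proof.
move=> clX xlim.
have /choice[z zP] : forall n : nat, exists z,
    X z /\ forall i, (`|i| <= n)%N -> z i = x i.
  by move=> n; have [z Xz zx] := xlim n; exists z.
apply: (@closed_cvg _ _ \oo _ z X clX); first by apply: nearW => n; have [] := zP n.
apply: full_shift_cvg => i; exists `|i|%N => // n /= ilen.
by have [_ ->] := zP n.
Qed.

(** * Letter-to-letter maps and shifts given by allowed transitions *)

Definition letter_map (A B : finType) (f : B -> A) (y : full_shift B) :
  full_shift A := fun i => f (y i).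

Lemma continuous_letter_map (A B : finType) (f : B -> A) :
  continuous (letter_map f).
Proof.
move=> y; have FF := @fmap_filter _ _ (letter_map f) _ (nbhs_filter y).
apply: (full_shift_cvg (F := fmap (letter_map f) (nbhs y)) FF) => i.
apply: (@filterS _ _ (nbhs_filter y) _ _ _ (near_coordinate y i)) => z yz.
by rewrite /letter_map /= yz.
Qed.

(** The alphabet is finite, so the pairs violating [e] form a finite list of forbidden words of
    length two. *)
Lemma vertex_shift_SFT (B : finType) (e : B -> B -> Prop) :
  is_SFT [set y : full_shift B | forall i, e (y i) (y (i + 1)%R)].
Proof.
exists [seq [:: p.1; p.2] | p <- enum {: B * B} & `[< ~ e p.1 p.2 >]].
apply/seteqP; split=> y /= yP.
  move=> w /mapP[p]; rewrite mem_filter => /andP[/asboolP pe _] ->.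
  by move=> [i [p1 p2]]; apply: pe; rewrite p1 p2 addr0; exact: yP.
move=> i; apply: contrapT => nei.
apply: (yP [:: y i; y (i + 1)%R]); last by exists i; rewrite /mkseq /= addr0.
apply/mapP; exists (y i, y (i + 1)%R) => //.
by rewrite mem_filter mem_enum andbT; apply/asboolP.
Qed.

(** * Stabilising follower sets along the past of a point *)

Lemma antitone_stabilises (T : Type) (u : nat -> set T) :
  (forall n, u n.+1 `<=` u n) -> finite_set (range u) ->
  exists N, forall n, (N <= n)%N -> u n = u N.
Proof.
move=> uS /finite_seqP[s sE].
have uanti m n : (m <= n)%N -> u n `<=` u m.
  by move=> /subnK <-; elim: (n - m)%N => // k IH t /uS /IH.
(* [b t] is a time from which the value [t] never occurs again, if there is one, and arbitrary
   otherwise. *)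
have /choice[b bP] : forall t, exists b,
    (exists m, forall n, (m <= n)%N -> u n <> t) ->
    forall n, (b <= n)%N -> u n <> t.
  move=> t; have [[m mt]|nt] :=
    pselect (exists m, forall n, (m <= n)%N -> u n <> t).
    by exists m.
  by exists 0%N.
exists (\max_(t <- s) b t) => n; set N := \max_(t <- s) b t => Nn.
apply/seteqP; split; first exact: uanti.
(* As [N] is at least [b (u N)], the value [u N] recurs arbitrarily late, and monotonicity squeezes
   [u n] between two copies of it. *)
have [m nm <-] : exists2 m, (n <= m)%N & u m = u N; last exact: uanti.
apply: contrapT => nex; apply: (bP (u N) _ N) => //.
  by exists n => m nm umN; apply: nex; exists m.
have : [set` s] (u N) by rewrite -sE; exists N.
by move=> /= uNs; exact: (leq_bigmax_seq (u N) uNs).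
Qed.

(** The coordinate [i] is excluded, so that appending [x i] yields a past of [i + 1]. *)
Definition past (A : finType) (x : full_shift A) (i : int) (n : nat) : seq A :=
  mkseq (fun k => x (i - n%:Z + k%:Z)%R) n.

Lemma past_consl (A : finType) (x : full_shift A) i n :
  past x i n.+1 = [:: x (i - n.+1%:Z)%R] ++ past x i n.
Proof.
rewrite /past /mkseq /= addr0 (iotaDl 1 0) -map_comp; congr cons.
by apply: eq_map => k /=; congr x; lia.
Qed.

Lemma past_rcons (A : finType) (x : full_shift A) i n :
  past x (i + 1)%R n.+1 = past x i n ++ [:: x i].
Proof.
rewrite /past mkseqS -cats1; congr (_ ++ [:: _]); last by congr x; lia.
by apply: eq_map => k /=; congr x; lia.
Qed.

Lemma language_past (A : finType) (X : set (full_shift A)) x i n :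
  X x -> language X (past x i n).
Proof. by move=> Xx; exists x => //; exists (i - n%:Z)%R; rewrite size_mkseq. Qed.

(* The follower sets of the longer and longer pasts of [x i] decrease, so they
   stabilise; the limits are the vertices of a path labelled by [x]. *)
Lemma follower_path (A : finType) (X : set (full_shift A)) (x : full_shift A) :
  finite_set (follower X @` language X) -> X x ->
  exists q : int -> set (nat -> A),
    (forall i, (follower X @` language X) (q i)) /\
    (forall i, q (i + 1)%R = word_cat [:: x i] @^-1` q i).
Proof.
move=> finX Xx; pose u i n := follower X (past x i n).
have uX i n : (follower X @` language X) (u i n).
  by exists (past x i n) => //; exact: language_past.
have /choice[N NP] : forall i, exists N, forall n, (N <= n)%N -> u i n = u i N.
  move=> i; apply: antitone_stabilises => [n|].
    by rewrite /u past_consl; exact: follower_suffix.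
  by apply: sub_finite_set finX => _ [n _ <-].
exists (fun i => u i (N i)); split=> // i.
(* From length [m] on both limits are reached; the past of [i + 1] is taken one letter longer
   because it ends in [x i]. *)
pose m := maxn (N i) (N (i + 1)%R).
rewrite -(NP i m) ?leq_maxl// -(NP (i + 1)%R m.+1) ?leqW ?leq_maxr//.
by rewrite /u past_rcons follower_cat.
Qed.

(** * Soficity from finitely many follower sets *)

Lemma finite_followers_sofic (A : finType) (X : set (full_shift A)) :
  is_subshift X -> finite_set (follower X @` language X) -> is_sofic X.
Proof.
move=> subX finX; have [s sE] := (finite_seqP _).1 finX.
(* A symbol is an edge, stored as source vertex and label; [e b c] says that [c] starts where [b]
   ends. *)
pose e (b c : seq_sub s * A) := ssval c.1 = word_cat [:: b.2] @^-1` ssval b.1.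
pose Y := [set y : full_shift (seq_sub s * A)%type |
  forall i, e (y i) (y (i + 1)%R)].
exists (seq_sub s * A)%type, Y, (letter_map snd); split=> //.
- exact: vertex_shift_SFT.
- by apply: continuous_subspaceT; exact: continuous_letter_map.
apply/seteqP; split=> [_ [y Yy <-]|x Xx].
  have qX i : (follower X @` language X) (ssval (y i).1).
    by rewrite sE /=; exact: ssvalP.
  apply: closed_pointwise; first by case: subX.
  (* Take [w] whose follower set is the vertex at [-n] and read the labels on [[-n, n]] after it.
     The vertex reached is the follower set of a word of the language, hence nonempty, so some point
     of [X] carries these labels. *)
  move=> n; have [w _ wE] := qX (- n%:Z)%R.
  pose v j := mkseq (fun k => (y (- n%:Z + k%:Z)%R).2) j.
  have vE j : follower X (w ++ v j) = ssval (y (- n%:Z + j%:Z)%R).1.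
    elim: j => [|j IH]; first by rewrite /v cats0 addr0.
    rewrite /v mkseqS -cats1 catA follower_cat IH.
    by rewrite -addn1 PoszD addrA Yy.
  have [r] : exists r, follower X (w ++ v n.*2.+1) r.
    rewrite vE; have [w' w'X <-] := qX (- n%:Z + n.*2.+1%:Z)%R.
    by apply/language_follower.
  (* The translation moves the label read at coordinate 0 of [y], which has index [size w + n] after
     [i], back to coordinate 0. *)
  move=> [z Xz [i zE]]; exists (fun t => z (t + (i + (size w + n)%N%:Z))%R).
    exact: (subshift_translate _ subX Xz).
  move=> t tn; pose k := absz (t + n%:Z)%R.
  have kE : (k%:Z = t + n%:Z)%R by rewrite /k; lia.
  have -> : (t + (i + (size w + n)%N%:Z) = i + (size w + k)%N%:Z)%R by lia.
  rewrite zE word_cat_cat word_cat_addn (@word_cat_nth _ _ _ (y t).2).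
    rewrite nth_mkseq; last by lia.
    by congr (y _).2; lia.
  by rewrite size_mkseq; lia.
have [q [qX qS]] := follower_path finX Xx.
have qs i : q i \in s by have := qX i; rewrite sE.
by exists (fun i => (SeqSub (qs i), x i)) => // i; exact: qS.
Qed.

(** * Counting follower sets of words of bounded length *)

Definition followers_upto (A : finType) (X : set (full_shift A)) (n : nat) :=
  \bigcup_(l in [set l : nat | (1 <= l <= n)%N]) followers X l.

Lemma followers_uptoP (A : finType) (X : set (full_shift A)) n q :
  followers_upto X n q <-> exists w,
    [/\ language X w, (0 < size w <= n)%N & follower X w = q].
Proof.
split=> [[l ln [w [wX wl] <-]]|[w [wX wn <-]]]; first by exists w; rewrite wl.
by exists (size w) => //; exists w.
Qed.

(** By induction, [w] can be replaced by a word of length at most [k] with the same follower set;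
    appending the last letter then gives length at most [k.+1]. *)
Lemma followers_upto_stable (A : finType) (X : set (full_shift A)) k w :
  (0 < k)%N -> followers_upto X k.+1 `<=` followers_upto X k ->
  language X w -> (0 < size w)%N -> followers_upto X k (follower X w).
Proof.
move=> k0 stab; elim/last_ind: w => // w a IH waX _.
have [wk|kw] := leqP (size w) k.
  by apply: stab; apply/followers_uptoP; exists (rcons w a); rewrite size_rcons.
move: waX; rewrite -cats1 => waX.
have /followers_uptoP[w' [w'X /andP[w'0 w'k] /esym ww']] :=
  IH (language_prefix waX) (leq_trans k0 (ltnW kw)).
have [w'aX ->] := follower_cat_congr ww' waX.
apply: stab; apply/followers_uptoP; exists (w' ++ [:: a]).
by rewrite size_cat addn1.
Qed.

Lemma finite_followers (A : finType) (X : set (full_shift A)) n :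
  finite_set (followers_upto X n) ->
  (forall w, language X w -> (0 < size w)%N -> followers_upto X n (follower X w)) ->
  finite_set (follower X @` language X).
Proof.
move=> finn allw.
apply: (@sub_finite_set _ _ (follower X [::] |` followers_upto X n)); last first.
  by rewrite finite_setU; split; first exact: finite_set1.
move=> _ [[|a w] wX <-]; first by left.
by right; exact: allw.
Qed.

Lemma follower_nil (A : finType) (X : set (full_shift A)) s :
  follower X [::] s -> exists a, follower X [:: a] s.
Proof.
move=> [x Xx [i xE]]; exists (x (i - 1)%R), x => //; exists (i - 1)%R => -[|k].
  by rewrite addr0.
rewrite (word_cat_addn [:: _] s k) -(word_cat_addn [::] s k) -xE.
by rewrite add0n; congr x; lia.
Qed.

(* A single follower set for all letters is also the follower set of the empty
   word, since every sequence is preceded by some letter. *)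
Lemma followers_of_letters_eq (A : finType) (X : set (full_shift A)) E w :
  (forall a, language X [:: a] -> follower X [:: a] = E) ->
  language X w -> follower X w = E.
Proof.
move=> XE; have nilE s : follower X [::] s -> E s.
  move=> /follower_nil[a as_]; rewrite -(XE a)//.
  by apply/language_follower; exists s.
elim/last_ind: w => [nilX|w a IH].
  apply/seteqP; split=> // s Es.
  (* The language must contain a letter [a]: one precedes any element of the follower set of the
     empty word. Then [E], being the follower set of [a], lies in that of the empty word. *)
  have /language_follower[r /follower_nil[a ar]] := nilX.
  apply: (@follower_suffix _ _ [:: a] [::]); rewrite XE//.
  by apply/language_follower; exists r.
rewrite -cats1 => waX.
(* Once [w] and the empty word share a follower set, so do [wa] and the one-letter word [a]. *)
have wE : follower X w = follower X [::].
  rewrite IH; last exact: language_prefix waX.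
  apply/seteqP; split=> [r|]; last exact: nilE.
  rewrite -(XE a (language_suffix waX)).
  exact: (@follower_suffix _ _ [:: a] [::]).
by have [aX ->] := follower_cat_congr wE waX; exact: XE.
Qed.

Theorem theorem4p6 (A : finType) (X : set (full_shift A)) :
  is_subshift X ->
  (exists2 n : nat, (0 < n)%N &
     (\bigcup_(l in [set l : nat | (1 <= l <= n)%N]) followers X l
        #<= `I_n)%card) ->
  is_sofic X.
Proof.
move=> subX [n n0 cardn]; apply: finite_followers_sofic => //.
apply: contrapT => infX.
have finn : finite_set (followers_upto X n) by apply/finite_set_leP; exists n.
have mono k m : (k <= m)%N -> followers_upto X k `<=` followers_upto X m.
  move=> km q /followers_uptoP[w [wX /andP[w0 wk] wq]]; apply/followers_uptoP.
  by exists w; rewrite w0 (leq_trans wk).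
have fin k : (k <= n)%N -> finite_set (followers_upto X k).
  by move=> kn; apply: sub_finite_set finn; exact: mono.
have letters E : exists2 a, language X [:: a] & follower X [:: a] <> E.
  apply: contrapT => nex; apply: infX.
  apply: (@sub_finite_set _ _ [set E]); last exact: finite_set1.
  move=> _ [w wX <-]; apply: followers_of_letters_eq wX => a aX.
  by apply: contrapT => aE; apply: nex; exists a.
have strict k : (0 < k <= n)%N -> ~ followers_upto X k.+1 `<=` followers_upto X k.
  move=> /andP[k0 kn] stab; apply: infX.
  apply: finite_followers (fin k kn) _ => w wX w0.
  exact: followers_upto_stable.
(* At least [k + 2] follower sets come from lengths up to [k + 1]: two distinct ones from letters,
   then at least one more for each further length. *)
have count k : (k < n)%N -> (k.+1 < #|` fset_set (followers_upto X k.+1)|)%N.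
  elim: k => [_|k IH kn].
    (* The value [set0] is arbitrary: this first use only supplies a letter, and the second one a
       letter with another follower set. *)
    have [a aX _] := letters set0; have [b bX ba] := letters (follower X [:: a]).
    have sub : ([fset follower X [:: a]; follower X [:: b]] `<=`
        fset_set (followers_upto X 1))%fset.
      apply/fsubsetP => q; rewrite in_fset2 in_fset_set; last exact: fin.
      move=> /orP[]/eqP->; apply/mem_set.
        by apply/followers_uptoP; exists [:: a].
      by apply/followers_uptoP; exists [:: b].
    by have := fsubset_leq_card sub; rewrite cardfs2 eq_sym (introN eqP ba).
  apply: (leq_ltn_trans (IH (ltnW kn))); apply: fproper_ltn_card.
  have [fink fink1] := (fin _ (ltnW kn), fin _ kn).
  rewrite fproperE; apply/andP; split.
    by rewrite -fset_set_sub//; exact: mono.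
  by apply/negP; rewrite -fset_set_sub//; apply: strict; rewrite (ltnW kn).
(* At [k = n - 1] the count exceeds [n], against the assumed bound. *)
have := geq_card_fset_set cardn.
have := count n.-1; rewrite prednK// leqnn => /(_ isT) /leq_trans/[apply].
by rewrite ltnn.
Qed.
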